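(* Let $n\ge1$ and let $\mathbb{Q}\mathcal{Y}_n$ be the $\mathbb{Q}$-vector space with basis the set $\mathcal{Y}_n$ of Young diagrams with at most $n$ rows. The linear operators $\widehat D_-,\widehat D_0,\widehat D_+$ on $\mathbb{Q}\mathcal{Y}_n$ acting on $\lambda\in\mathcal{Y}_n$ by $$\widehat D_-(\lambda)=-\big(n\,\xi_-(\lambda)+\nabla_-(\lambda)\big),\qquad \widehat D_0(\lambda)=2|\lambda|\,\lambda,\qquad \widehat D_+(\lambda)=\nabla_+(\lambda)$$ define an $\mathfrak{sl}_2$-action on $\mathbb{Q}\mathcal{Y}_n$; that is, $[\widehat D_+,\widehat D_-]=\widehat D_0$, $[\widehat D_0,\widehat D_+]=2\widehat D_+$ and $[\widehat D_0,\widehat D_-]=-2\widehat D_-$.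
   Context: Young diagrams with at most $n$ rows are identified with partitions having at most $n$ nonzero parts; $|\lambda|$ is the number of cells of $\lambda$. The content of a cell $\square=(i,j)$ (row $i$, column $j$) is $c(\square)=j-i$. The linear operators $\xi_-,\nabla_\pm$ on $\mathbb{Q}\mathcal{Y}_n$ are defined on $\lambda\in\mathcal{Y}_n$ by $$\xi_-(\lambda)=\sum_{\mu=\lambda-\square\in\mathcal{Y}_n}\mu,\qquad \nabla_\pm(\lambda)=\sum_{\mu=\lambda\pm\square\in\mathcal{Y}_n}c(\square)\,\mu,$$ where the sums run over all $\mu\in\mathcal{Y}_n$ obtained from $\lambda$ by removing (for $-$) or adding (for $+$) exactly one cell $\square$. The Lie algebra $\mathfrak{sl}_2$ has basis $\mathfrak{e}_-,\mathfrak{h},\mathfrak{e}_+$ with $[\mathfrak{h},\mathfrak{e}_+]=2\mathfrak{e}_+$, $[\mathfrak{h},\mathfrak{e}_-]=-2\mathfrak{e}_-$, $[\mathfrak{e}_+,\mathfrak{e}_-]=\mathfrak{h}$, and $\mathfrak{e}_\pm\mapsto\widehat D_\pm$, $\mathfrak{h}\mapsto\widehat D_0$. *)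

(* Defs.v *)
From mathcomp Require Import all_boot all_order all_algebra.
From mathcomp Require Import freeg.

Set Implicit Arguments.
Unset Strict Implicit.
Unset Printing Implicit Defensive.

Import GRing.Theory.

Local Open Scope ring_scope.

(* A Young diagram with at most n rows, given by its weakly decreasing row
   lengths, padded with zeros to length n. *)
Definition diagram (n : nat) := {t : n.-tuple nat | sorted geq t}.

Definition row_length (n : nat) (lam : diagram n) (i : 'I_n) : nat :=
  tnth (val lam) i.

Definition ncells (n : nat) (lam : diagram n) : nat :=
  (\sum_(i < n) row_length lam i)%N.

(* Rows and columns are numbered from 0 on; the content j - i of a cell is the
   same as with numbering from 1 on. *)
Definition content (i j : nat) : rat := j%:R - i%:R.

Definition set_row (n : nat) (lam : diagram n) (i : 'I_n) (k : nat) :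
    n.-tuple nat :=
  [tuple if j == i then k else row_length lam j | j < n].

(* The diagram lam + (i, row_length lam i), or None if this is not a diagram. *)
Definition add_cell (n : nat) (lam : diagram n) (i : 'I_n) :
    option (diagram n) :=
  insub (set_row lam i (row_length lam i).+1).

(* The diagram lam - (i, (row_length lam i).-1), or None if row i is empty or
   this is not a diagram. *)
Definition remove_cell (n : nat) (lam : diagram n) (i : 'I_n) :
    option (diagram n) :=
  if (0 < row_length lam i)%N
  then insub (set_row lam i (row_length lam i).-1) : option (diagram n)
  else None.

Definition QY (n : nat) := {freeg (diagram n) / rat}.

(* The basis vector of a diagram. *)
Definition basis_vec (n : nat) (lam : diagram n) : QY n := << lam >>.

(* [fglift f] is the linear operator whose value on the basis vector of lam is
   f lam. *)
Definition xi_minus (n : nat) : QY n -> QY n :=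
  fglift (fun lam => \sum_(i < n)
    if remove_cell lam i is Some mu then basis_vec mu else 0).

Definition nabla_minus (n : nat) : QY n -> QY n :=
  fglift (fun lam => \sum_(i < n)
    if remove_cell lam i is Some mu
    then content i (row_length lam i).-1 *: basis_vec mu else 0).

Definition nabla_plus (n : nat) : QY n -> QY n :=
  fglift (fun lam => \sum_(i < n)
    if add_cell lam i is Some mu
    then content i (row_length lam i) *: basis_vec mu else 0).

Definition D_minus (n : nat) : QY n -> QY n :=
  fglift (fun lam =>
    - (n%:R *: xi_minus (basis_vec lam) + nabla_minus (basis_vec lam))).

Definition D_zero (n : nat) : QY n -> QY n :=
  fglift (fun lam => (2 * (ncells lam)%:R) *: basis_vec lam).

Definition D_plus (n : nat) : QY n -> QY n :=
  fglift (fun lam => nabla_plus (basis_vec lam)).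

Definition commutator (V : zmodType) (f g : V -> V) (v : V) : V :=
  f (g v) - g (f v).

(* sl_2 is the space of trace-zero 2 x 2 rational matrices with bracket
   x y - y x; [rho] is only constrained on that space. *)
Definition sl2_action (V : lmodType rat) (rho : 'M[rat]_2 -> V -> V) : Prop :=
  [/\ forall x, \tr x = 0 -> linear (rho x),
      forall (a : rat) x y, \tr x = 0 -> \tr y = 0 ->
        forall v, rho (a *: x + y) v = a *: rho x v + rho y v
    & forall x y, \tr x = 0 -> \tr y = 0 ->
        rho (x *m y - y *m x) =1 commutator (rho x) (rho y)].

Definition sl2_e_plus : 'M[rat]_2 := delta_mx 0 1.
Definition sl2_e_minus : 'M[rat]_2 := delta_mx 1 0.
Definition sl2_h : 'M[rat]_2 := delta_mx 0 0 - delta_mx 1 1.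

(* Main.v *)
(* In [D_plus, D_minus] applied to a diagram lam, removing a cell from row j and
   adding one to row i <> j can be done in either order: the intermediate
   diagrams are the row-wise minimum and maximum of lam and the result, hence
   are diagrams as soon as the result is. The coefficients only depend on the
   row involved, so these terms cancel and the commutator is
   diagonal. *)
Require Import Defs.
From HB Require Import structures.
From mathcomp Require Import all_boot all_order all_algebra.
From mathcomp Require Import freeg.
From mathcomp Require Import zify ring.

Set Implicit Arguments.
Unset Strict Implicit.
Unset Printing Implicit Defensive.

Import GRing.Theory.

Local Open Scope ring_scope.

(** * Linear maps determined by their values on a basis *)

Section FreegLift.

Variables (R : nzRingType) (K : choiceType) (M : lmodType R).

HB.instance Definition _ (f : K -> M) :=
  GRing.isZmodMorphism.Build {freeg K / R} M (fglift f) (@lift_is_additive R K M f).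

Lemma fglift_scalable (f : K -> M) :
  scalable (fglift f : {freeg K / R} -> M).
Proof.
move=> c u; rewrite -[u in RHS]freeg_sumE -[c *: u]/(fgscale c u) /fgscale.
rewrite !raddf_sum.
by apply: eq_bigr => x _; rewrite /= !liftU scalerA.
Qed.

HB.instance Definition _ (f : K -> M) :=
  GRing.isScalable.Build R {freeg K / R} M *:%R (fglift f) (@fglift_scalable f).

(** Reduces each operator identity to a check on single diagrams. *)
Lemma eq_linear_freeg (f g : {linear {freeg K / R} -> M}) :
  (forall x, f << x >> = g << x >>) -> f =1 g.
Proof.
move=> fg u; rewrite -[u]freeg_sumE !linear_sum; apply: eq_bigr => x _.
suff -> : << coeff x u *g x >> = coeff x u *: (<< x >> : {freeg K / R}).
  by rewrite !linearZ fg.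
by apply/eqP/freeg_eqP => y; rewrite coeffZ !coeffU mul1r.
Qed.

End FreegLift.

HB.instance Definition _ n := GRing.Linear.copy (@D_plus n) (fglift _).
HB.instance Definition _ n := GRing.Linear.copy (@D_minus n) (fglift _).
HB.instance Definition _ n := GRing.Linear.copy (@D_zero n) (fglift _).

(** * Adding and removing cells, and the operators on basis vectors *)

Section Cells.

Variable n : nat.
Implicit Types (lam mu : diagram n) (i j : 'I_n).

Lemma row_length_anti lam i j :
  (i <= j)%N -> (row_length lam j <= row_length lam i)%N.
Proof.
move=> ij; rewrite /row_length !(tnth_nth 0%N).
have := sorted_leq_nth (leT := geq) _ _ 0%N (valP lam).
apply; rewrite ?inE ?size_tuple //; first by move=> a b c /=; lia.
by move=> a /=.
Qed.

(** The source of every diagram built below: only the row lengths have to be given and shown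
    antitone. *)
Lemma diagram_of_rows (f : 'I_n -> nat) :
  (forall i j, (i <= j)%N -> (f j <= f i)%N) ->
  exists lam, row_length lam =1 f.
Proof.
move=> f_anti; have f_sorted : sorted geq [tuple f i | i < n].
  apply/(sortedP 0%N) => k; rewrite size_tuple => kn.
  rewrite -(tnth_nth 0%N _ (Ordinal kn)) -(tnth_nth 0%N _ (Ordinal (ltnW kn))).
  by rewrite !tnth_mktuple; apply: f_anti => /=.
exists (exist (fun t : n.-tuple nat => sorted geq t) _ f_sorted) => i.
by rewrite /row_length tnth_mktuple.
Qed.

Lemma insub_set_row lam i k mu :
  (insub (set_row lam i k) = Some mu) <->
  (forall j, row_length mu j = if j == i then k else row_length lam j).
Proof.
split=> [ins_mu j | mu_rows].
  have mu_val : val mu = set_row lam i k by case: insubP ins_mu => // u _ <- [->].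
  by rewrite /row_length mu_val tnth_mktuple.
suff <- : val mu = set_row lam i k by rewrite valK.
by apply: eq_from_tnth => j; rewrite tnth_mktuple -mu_rows.
Qed.

Lemma add_cellP lam i mu :
  add_cell lam i = Some mu <->
  (forall j, row_length mu j = (row_length lam j + (j == i))%N).
Proof.
rewrite insub_set_row; split=> H j; rewrite H; case: eqP => [->|] /=; lia.
Qed.

(** The row condition is that of [add_cellP] with [lam] and [mu] exchanged, so removal and addition
    are inverse relations. *)
Lemma remove_cellP lam i mu :
  remove_cell lam i = Some mu <->
  (forall j, row_length lam j = (row_length mu j + (j == i))%N).
Proof.
rewrite /remove_cell; case: ltnP => [lam_i_gt0|lam_i0].
  by rewrite insub_set_row; split=> H j; move: (H j); case: eqP => [->|] /=; lia.
by split=> // /(_ i); rewrite eqxx; lia.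
Qed.

Lemma obindP (T U : Type) (f : T -> option U) o y :
  obind f o = Some y <-> exists2 x, o = Some x & f x = Some y.
Proof.
case: o => [x|] /=; last by split=> // -[].
by split=> [fx|[z [<-]]] //; exists x.
Qed.

Lemma add_remove_cell lam i j : i != j ->
  obind (@remove_cell n ^~ j) (add_cell lam i) =
  obind (@add_cell n ^~ i) (remove_cell lam j).
Proof.
move=> neq_ij.
suff eq_Some nu : obind (@remove_cell n ^~ j) (add_cell lam i) = Some nu <->
                  obind (@add_cell n ^~ i) (remove_cell lam j) = Some nu.
  case eqL: (obind _ (add_cell _ _)) => [nu|].
    by apply/esym/eq_Some.
  by case eqR: (obind _ _) => [nu|] //; rewrite -eqL; apply/eq_Some.
rewrite !obindP; split=> -[mu].
  move=> /add_cellP mu_rows /remove_cellP nu_rows.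
  (* Here [nu] is [lam] with row [i] longer and row [j] shorter by one; as [i != j], the minimum
     only shortens row [j] of [lam]. *)
  have [k l kl|mu' mu'_rows] := @diagram_of_rows
      (fun k => minn (row_length lam k) (row_length nu k)).
    by have := row_length_anti lam kl; have := row_length_anti nu kl; lia.
  exists mu'; [apply/remove_cellP | apply/add_cellP] => k;
    have := mu_rows k; rewrite nu_rows mu'_rows; move: neq_ij;
    by rewrite -!val_eqE /=; lia.
move=> /remove_cellP mu_rows /add_cellP nu_rows.
have [k l kl|mu' mu'_rows] := @diagram_of_rows
    (fun k => maxn (row_length lam k) (row_length nu k)).
  by have := row_length_anti lam kl; have := row_length_anti nu kl; lia.
exists mu'; [apply/add_cellP | apply/remove_cellP] => k;
  have := mu_rows k; rewrite mu'_rows nu_rows; move: neq_ij;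
  by rewrite -!val_eqE /=; lia.
Qed.

Lemma addK_cell lam i :
  obind (@remove_cell n ^~ i) (add_cell lam i) =
  if add_cell lam i then Some lam else None.
Proof.
by case eq_mu: (add_cell lam i) => [mu|] //=; apply/remove_cellP/add_cellP.
Qed.

Lemma removeK_cell lam i :
  obind (@add_cell n ^~ i) (remove_cell lam i) =
  if remove_cell lam i then Some lam else None.
Proof.
by case eq_mu: (remove_cell lam i) => [mu|] //=; apply/add_cellP/remove_cellP.
Qed.

(** Comparing with all earlier rows, not just the previous one, treats the first row uniformly: its
    condition is vacuous. *)
Lemma add_cell_some lam i :
  (add_cell lam i : bool) =
  [forall k : 'I_n, (k < i)%N ==> (row_length lam i < row_length lam k)%N].
Proof.
apply/idP/forallP => [|anti].
  case eq_mu: (add_cell lam i) => [mu|] // _ k; apply/implyP => ki.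
  have := row_length_anti mu (ltnW ki); move/add_cellP: eq_mu => mu_rows.
  rewrite !mu_rows eqxx; suff /negPf -> : k != i by lia.
  by rewrite -val_eqE /=; lia.
have [k l kl|mu /add_cellP -> //] := @diagram_of_rows
    (fun k => row_length lam k + (k == i))%N.
have := row_length_anti lam kl; have /implyP := anti k.
move: kl; case: (eqVneq k i) => [->|]; case: (eqVneq l i) => [->|];
  rewrite -?(inj_eq val_inj) /=; lia.
Qed.

Lemma remove_cell_some lam i :
  (remove_cell lam i : bool) = (0 < row_length lam i)%N &&
  [forall k : 'I_n, (i < k)%N ==> (row_length lam k < row_length lam i)%N].
Proof.
apply/idP/andP => [|[lam_i_gt0 /forallP anti]].
  case eq_mu: (remove_cell lam i) => [mu|] // _.
  move/remove_cellP: eq_mu => mu_rows; split; first by rewrite mu_rows eqxx; lia.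
  apply/forallP => k; apply/implyP => ik.
  have := row_length_anti mu (ltnW ik).
  rewrite !mu_rows eqxx; suff /negPf -> : k != i by lia.
  by rewrite -val_eqE /=; lia.
(* The truncated subtraction is exact, because row [i] is nonempty by [lam_i_gt0]. *)
have [k l kl|mu mu_rows] := @diagram_of_rows
    (fun k => row_length lam k - (k == i))%N.
  have := row_length_anti lam kl; have /implyP := anti l.
  move: kl; case: (eqVneq k i) => [->|]; case: (eqVneq l i) => [->|];
    rewrite -?(inj_eq val_inj) /=; lia.
have /remove_cellP -> // :
    forall k, row_length lam k = (row_length mu k + (k == i))%N.
  by move=> k; rewrite mu_rows; have [->|] := eqVneq k i; lia.
Qed.

Lemma ncells_add_cell lam i mu :
  add_cell lam i = Some mu -> ncells mu = (ncells lam).+1.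
Proof.
move=> /add_cellP mu_rows; rewrite /ncells (eq_bigr _ (fun j _ => mu_rows j)).
rewrite big_split /= -addn1; congr addn.
by rewrite (bigD1 i) //= eqxx big1 // => j /negPf ->.
Qed.

Lemma ncells_remove_cell lam i mu :
  remove_cell lam i = Some mu -> ncells lam = (ncells mu).+1.
Proof. by move=> /remove_cellP/add_cellP; apply: ncells_add_cell. Qed.

(** Sending impossible moves to zero lets all sums run over all rows, and turns composition of
    operators into [obind]. *)
Definition basis_or0 (o : option (diagram n)) : QY n :=
  if o is Some mu then basis_vec mu else 0.

Lemma D_plus_basis lam :
  D_plus (basis_vec lam) =
  \sum_(i < n) content i (row_length lam i) *: basis_or0 (add_cell lam i).
Proof.
rewrite /D_plus /nabla_plus /basis_vec !liftU !scale1r.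
by apply: eq_bigr => i _; case: add_cell => //=; rewrite scaler0.
Qed.

(* [weight_minus x] is the coefficient in [D_minus lam] of removing a cell from
   a row, where [x] is the content of the first cell beyond that row, so that
   the removed cell has content [x - 1]. *)
Definition weight_minus (x : rat) : rat := - (n%:R + x - 1).

Lemma D_minus_basis lam :
  D_minus (basis_vec lam) =
  \sum_(i < n)
    weight_minus (content i (row_length lam i)) *: basis_or0 (remove_cell lam i).
Proof.
rewrite /D_minus /xi_minus /nabla_minus /basis_vec !liftU !scale1r.
rewrite scaler_sumr -big_split -sumrN; apply: eq_bigr => i _.
case eq_mu: (remove_cell lam i) => [mu|] /=; last by rewrite !scaler0 addr0 oppr0.
rewrite -scalerDl -scaleNr; congr (_ *: _).
move/remove_cellP: eq_mu => ->; rewrite eqxx addn1 /= /weight_minus /content.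
by rewrite -natr1; ring.
Qed.

Lemma D_zero_basis lam :
  D_zero (basis_vec lam) = (2 * (ncells lam)%:R) *: basis_vec lam.
Proof. by rewrite /D_zero /basis_vec liftU scale1r. Qed.

Lemma D_plus_basis_or0 o :
  D_plus (basis_or0 o) =
  \sum_(i < n) (if o is Some mu then content i (row_length mu i) else 0) *:
               basis_or0 (obind (@add_cell n ^~ i) o).
Proof.
case: o => [mu|] /=; first by rewrite D_plus_basis.
by rewrite linear0 big1 // => i _; rewrite scaler0.
Qed.

Lemma D_minus_basis_or0 o :
  D_minus (basis_or0 o) =
  \sum_(i < n)
    (if o is Some mu then weight_minus (content i (row_length mu i)) else 0) *:
    basis_or0 (obind (@remove_cell n ^~ i) o).
Proof.
case: o => [mu|] /=; first by rewrite D_minus_basis.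
by rewrite linear0 big1 // => i _; rewrite scaler0.
Qed.

(** Both coefficients are read off from [lam]: the first move changes the content used by the second
    only when both act on the same row, whence the correction [(i == j)]. *)
Lemma D_plus_D_minus_basis lam :
  D_plus (D_minus (basis_vec lam)) =
  \sum_(j < n) \sum_(i < n)
    (weight_minus (content j (row_length lam j)) *
     (content i (row_length lam i) - (i == j)%:R)) *:
    basis_or0 (obind (@add_cell n ^~ i) (remove_cell lam j)).
Proof.
rewrite D_minus_basis linear_sum; apply: eq_bigr => j _.
rewrite linearZ /= D_plus_basis_or0 scaler_sumr; apply: eq_bigr => i _.
rewrite scalerA; case eq_mu: (remove_cell lam j) => [mu|] /=; last by rewrite !scaler0.
move/remove_cellP: eq_mu => mu_rows; rewrite (mu_rows i) /content natrD.
by congr (_ *: _); ring.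
Qed.

Lemma D_minus_D_plus_basis lam :
  D_minus (D_plus (basis_vec lam)) =
  \sum_(j < n) \sum_(i < n)
    (content i (row_length lam i) *
     weight_minus (content j (row_length lam j) + (i == j)%:R)) *:
    basis_or0 (obind (@remove_cell n ^~ j) (add_cell lam i)).
Proof.
(* The removal row is kept as the outer index, so that both double sums can be subtracted term by
   term. *)
rewrite exchange_big D_plus_basis linear_sum; apply: eq_bigr => i _.
rewrite linearZ /= D_minus_basis_or0 scaler_sumr; apply: eq_bigr => j _.
rewrite scalerA; case eq_mu: (add_cell lam i) => [mu|] /=; last by rewrite !scaler0.
by move/add_cellP: eq_mu => ->; rewrite /content natrD eq_sym addrAC.
Qed.

End Cells.

(* With [f x = x (n + x)] and [x_i] the content of the first cell beyond row
   [i], the commutator multiplies [lam] by the sum of [f x_i] over addable rows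
   minus the sum of [f (x_i - 1)] over removable rows. A row [i.+1] is not
   addable exactly when row [i] is not removable, and then
   [x_(i.+1) = x_i - 1]; the last row is not removable only when it is empty,
   and then [f (x_i - 1) = f (- n) = 0]. So both sums may be taken over all
   rows. *)
Lemma sum_addable_removable m (lam : diagram m.+1)
    (f := fun x : rat => x * (m.+1%:R + x))
    (x := fun i : 'I_m.+1 => content i (row_length lam i)) :
  \sum_(i < m.+1) ((add_cell lam i : bool)%:R * f (x i) -
                   (remove_cell lam i : bool)%:R * f (x i - 1)) =
  2 * (ncells lam)%:R.
Proof.
have blocked : \sum_(i < m.+1) (~~ add_cell lam i)%:R * f (x i) =
               \sum_(i < m.+1) (~~ remove_cell lam i)%:R * f (x i - 1).
  rewrite big_ord_recl big_ord_recr /=.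
  have -> : (add_cell lam ord0 : bool).
    by rewrite add_cell_some; apply/forallP.
  rewrite mul0r add0r.
  have -> : (~~ remove_cell lam ord_max)%:R * f (x ord_max - 1) = 0.
    case row_max: (row_length lam ord_max) => [|k].
      by rewrite /f /x row_max /content /= -[m.+1%:R]natr1; ring.
    suff -> : (remove_cell lam ord_max : bool) by rewrite mul0r.
    rewrite remove_cell_some row_max /=; apply/forallP => j.
    by apply/implyP => /= jm; have := ltn_ord j; lia.
  rewrite addr0; apply: eq_bigr => i _.
  set i0 := widen_ord _ _; set i1 := fintype.lift _ _.
  have val_i1 : i1 = i.+1 :> nat by [].
  have le_rows := row_length_anti lam (leqnSn i : (i0 <= i1)%N).
  have eq_add : (add_cell lam i1 : bool) = (row_length lam i1 < row_length lam i0)%N.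
    rewrite add_cell_some; apply/forallP/idP => [/(_ i0)/implyP|lt_rows k].
      by apply; rewrite val_i1.
    apply/implyP => ki; apply: leq_trans lt_rows _; apply: row_length_anti.
    by rewrite /=; lia.
  have eq_rem : (remove_cell lam i0 : bool) = (row_length lam i1 < row_length lam i0)%N.
    rewrite remove_cell_some; apply/andP/idP => [[_ /forallP/(_ i1)/implyP]|lt_rows].
      by apply; rewrite val_i1.
    split; first by lia.
    apply/forallP => k; apply/implyP => /= ik.
    by apply: leq_ltn_trans lt_rows; apply: row_length_anti; rewrite val_i1.
  rewrite eq_add eq_rem; case: ltnP => [_|ge_rows] /=; first by rewrite !mul0r.
  have eq_rows : row_length lam i1 = row_length lam i0 by lia.
  by rewrite /x eq_rows /content val_i1 -[i.+1%:R]natr1 /=; congr (_ * f _); ring.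
have -> : \sum_(i < m.+1) ((add_cell lam i : bool)%:R * f (x i) -
                           (remove_cell lam i : bool)%:R * f (x i - 1)) =
          \sum_(i < m.+1) (f (x i) - f (x i - 1)).
  transitivity (\sum_(i < m.+1) (f (x i) - f (x i - 1)) -
      (\sum_(i < m.+1) (~~ add_cell lam i)%:R * f (x i) -
       \sum_(i < m.+1) (~~ remove_cell lam i)%:R * f (x i - 1))).
    rewrite -!sumrB; apply: eq_bigr => i _.
    by case: (add_cell lam i : bool); case: (remove_cell lam i : bool) => /=; ring.
  by rewrite blocked subrr subr0.
(* Since [f x - f (x - 1) = 2 * x + m], the row lengths contribute twice the number of cells and the
   remaining terms must sum to zero. *)
have -> : \sum_(i < m.+1) (f (x i) - f (x i - 1)) =
          \sum_(i < m.+1) (2 * (row_length lam i)%:R + (m%:R - 2 * i%:R)).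
  by apply: eq_bigr => i _; rewrite /f /x /content -[m.+1%:R]natr1; ring.
rewrite big_split /= -mulr_sumr -natr_sum -[RHS]addr0; congr (_ + _).
(* Passing from [m] to [m.+1] adds 1 to each of the [m.+1] old terms, and the new last term is
   [- m.+1]. *)
elim: m {lam f x blocked} => [|m IH]; first by rewrite big_ord1 mulr0 subr0.
rewrite big_ord_recr /=.
transitivity (\sum_(i < m.+1) (1 + (m%:R - 2 * i%:R)) + (m.+1%:R - 2 * m.+1%:R) : rat).
  by congr (_ + _); apply: eq_bigr => i _; rewrite -[m.+1%:R]natr1; ring.
by rewrite big_split IH sumr_const card_ord /=; ring.
Qed.

(** * The three commutation relations on a diagram *)

Lemma commutator_plus_minus m (lam : diagram m.+1) :
  commutator (@D_plus m.+1) (@D_minus m.+1) (basis_vec lam) =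
  D_zero (basis_vec lam).
Proof.
rewrite /commutator D_plus_D_minus_basis D_minus_D_plus_basis D_zero_basis.
rewrite -sum_addable_removable scaler_suml -sumrB; apply: eq_bigr => j _.
(* Only the terms with [i = j] survive; the others cancel by [add_remove_cell]. *)
rewrite (bigD1 j) //= [X in _ - X](bigD1 j) //= opprD addrACA -sumrB.
rewrite [X in _ + X]big1 ?addr0 => [|i neq_ij]; last first.
  by rewrite add_remove_cell // (negPf neq_ij) subr0 addr0 mulrC subrr.
have basis_or0_if b :
    basis_or0 (if b then Some lam else None) = (b : bool)%:R *: basis_vec lam.
  by case: b; rewrite ?scale1r ?scale0r.
rewrite addK_cell removeK_cell !basis_or0_if !scalerA -scalerBl eqxx mulr1n.
(* With [x] the content beyond row [j], [weight_minus x * (x - 1) = - f (x - 1)] and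
   [x * weight_minus (x + 1) = - f x], for the [f] of [sum_addable_removable]. *)
congr (_ *: _); rewrite /weight_minus; ring.
Qed.

Lemma commutator_zero_plus n (lam : diagram n) :
  commutator (@D_zero n) (@D_plus n) (basis_vec lam) = 2 *: D_plus (basis_vec lam).
Proof.
rewrite /commutator D_zero_basis linearZ /= D_plus_basis linear_sum /=.
rewrite !scaler_sumr -sumrB; apply: eq_bigr => i _.
case eq_mu: (add_cell lam i) => [mu|] /=; last by rewrite !scaler0 linear0 subr0.
rewrite linearZ /= D_zero_basis (ncells_add_cell eq_mu) !scalerA -natr1.
rewrite -scalerBl; congr (_ *: _); ring.
Qed.

Lemma commutator_zero_minus n (lam : diagram n) :
  commutator (@D_zero n) (@D_minus n) (basis_vec lam) =
  (-2) *: D_minus (basis_vec lam).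
Proof.
rewrite /commutator D_zero_basis linearZ /= D_minus_basis linear_sum /=.
rewrite !scaler_sumr -sumrB; apply: eq_bigr => i _.
case eq_mu: (remove_cell lam i) => [mu|] /=; last by rewrite !scaler0 linear0 subr0.
rewrite linearZ /= D_zero_basis (ncells_remove_cell eq_mu) !scalerA -natr1.
rewrite -scalerBl; congr (_ *: _); ring.
Qed.

(** * From the commutation relations to an action of trace-zero matrices *)

Section Sl2Rep.

Variables (K : choiceType) (E F H : {linear {freeg K / rat} -> {freeg K / rat}}).

(** The entries are the coordinates in the basis [sl2_e_plus], [sl2_e_minus], [sl2_h]; on trace-zero
    matrices the entry [x 1 1] is [- x 0 0]. *)
Definition sl2_rep (x : 'M[rat]_2) (v : {freeg K / rat}) : {freeg K / rat} :=
  x 0 1 *: E v + x 1 0 *: F v + x 0 0 *: H v.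

Lemma sl2_rep_action :
  commutator E F =1 H ->
  commutator H E =1 (fun v => 2 *: E v) ->
  commutator H F =1 (fun v => (-2) *: F v) ->
  sl2_action sl2_rep.
Proof.
move=> EF HE HF; split.
- move=> x _ a u v; rewrite /sl2_rep !linearP /=.
  by apply/eqP/freeg_eqP => k; rewrite !(coeffD, coeffZ); ring.
- move=> a x y _ _ v; rewrite /sl2_rep !mxE.
  by apply/eqP/freeg_eqP => k; rewrite !(coeffD, coeffZ); ring.
move=> x y tr_x tr_y v.
have mx11 (z : 'M[rat]_2) : \tr z = 0 -> z 1 1 = - z 0 0.
  move=> tr_z; apply/eqP; rewrite -addr_eq0 addrC -tr_z /mxtrace.
  by rewrite big_ord_recl big_ord1 (_ : fintype.lift _ _ = 1) //; apply: val_inj.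
(* These three rules bring mixed products into the order [F], [E], [H], after which both sides agree
   coefficientwise. *)
have EFv : E (F v) = H v + F (E v) by rewrite -EF subrK.
have HEv : H (E v) = 2 *: E v + E (H v) by rewrite -HE subrK.
have HFv : H (F v) = (-2) *: F v + F (H v) by rewrite -HF subrK.
rewrite /commutator /sl2_rep !linearD !linearZ /= EFv HEv HFv !mxE.
rewrite !big_ord_recl !big_ord0 (_ : fintype.lift _ _ = 1) //; last exact: val_inj.
rewrite (_ : ord0 = 0) ?mx11 //.
apply/eqP/freeg_eqP => k; rewrite !(coeffN, coeffD, coeffZ).
by ring.
Qed.

End Sl2Rep.

Theorem theorem7 (n : nat) (hn : (1 <= n)%N) :
  [/\ commutator (@D_plus n) (@D_minus n) =1 @D_zero n,
      commutator (@D_zero n) (@D_plus n) =1 (fun v : QY n => 2 *: D_plus v)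
    & commutator (@D_zero n) (@D_minus n) =1 (fun v : QY n => (-2) *: D_minus v)]
  /\ exists rho : 'M[rat]_2 -> QY n -> QY n,
      [/\ sl2_action rho,
          rho sl2_e_minus =1 @D_minus n,
          rho sl2_h =1 @D_zero n
        & rho sl2_e_plus =1 @D_plus n].
Proof.
have rel_pm : commutator (@D_plus n) (@D_minus n) =1 @D_zero n.
  apply: (eq_linear_freeg
    (f := ((@D_plus n) \o (@D_minus n)) \- ((@D_minus n) \o (@D_plus n)))
    (g := @D_zero n)) => lam.
  (* Positivity of [n] provides the first and last rows used in [sum_addable_removable]. *)
  by case: n hn lam => // m _ lam; apply: commutator_plus_minus.
have rel_0p : commutator (@D_zero n) (@D_plus n) =1 (fun v : QY n => 2 *: D_plus v).
  exact: (eq_linear_freeg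
    (f := ((@D_zero n) \o (@D_plus n)) \- ((@D_plus n) \o (@D_zero n)))
    (g := 2 \*: (@D_plus n)) (@commutator_zero_plus n)).
have rel_0m :
    commutator (@D_zero n) (@D_minus n) =1 (fun v : QY n => (-2) *: D_minus v).
  exact: (eq_linear_freeg
    (f := ((@D_zero n) \o (@D_minus n)) \- ((@D_minus n) \o (@D_zero n)))
    (g := (-2) \*: (@D_minus n)) (@commutator_zero_minus n)).
split=> //; exists (sl2_rep (@D_plus n) (@D_minus n) (@D_zero n)); split.
- exact: sl2_rep_action.
- by move=> v; rewrite /sl2_rep !mxE /= !scale0r scale1r add0r addr0.
- by move=> v; rewrite /sl2_rep !mxE /= subr0 !scale0r scale1r !add0r.
- by move=> v; rewrite /sl2_rep !mxE /= !scale0r scale1r !addr0.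
Qed.
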